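(* Consider an instance of the Colored Knapsack Problem whose items are sorted by color. The algorithm $\mathtt{DP_1}$ (defined in the context) computes, for all $i,t,d,a\in\{0,1,\dots,n\}$ and $q\in\{0,1,\dots,b\}$, the value $$f(i,t,d,a,q)=\max\Big\{p(S)\ \Big|\ S\subseteq\{1,\dots,i\},\ |S|=t,\ \overline{k}(S)=d,\ k_{\kappa_i}(S)=a,\ w(S)=q\Big\},$$ if a set $S$ satisfying these conditions exists, in at most $\mathcal{O}(b\,n^4)$ operations. (For $i=0$, where $\kappa_0$ is undefined, the only admissible set is $S=\emptyset$, with $t=d=a=q=0$.)
   Context: An instance of the Colored Knapsack Problem (CKP) consists of a set of items $\mathcal{I}=\{1,\dots,n\}$ with profits $p_i\in\mathbb{Z}$ (zero and negative profits allowed) and weights $w_i\in\mathbb{Z}_{>0}$, a capacity $b\in\mathbb{Z}_{>0}$ with $b<\sum_{i=1}^n w_i$, a set of colors $\mathcal{C}=\{1,\dots,m\}$, and a color $\kappa_i\in\mathcal{C}$ for each item $i$. ''Sorted by color'' means that items of the same color have consecutive indices. For $S\subseteq\mathcal{I}$: $p(S)=\sum_{i\in S}p_i$, $w(S)=\sum_{i\in S}w_i$, $k_c(S)=|\{i\in S\mid\kappa_i=c\}|$ for $c\in\mathcal{C}$, and $\overline{k}(S)=\max_{c\in\mathcal{C}}k_c(S)$. Let $\sigma(a,d)=1$ if $d\le a$ and $\sigma(a,d)=0$ otherwise. Algorithm $\mathtt{DP_1}$. Initialize a table $f(i,t,d,a,q)\gets-\infty$ for all $i,t,d,a\in\{0,\dots,n\}$,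 $q\in\{0,\dots,b\}$; then set $f(0,0,0,0,0)\gets 0$. For $i=1,2,\dots,n$ and for each $(t,d,a,q)$ with $f(i-1,t,d,a,q)>-\infty$ do the following: (1) set $a'\gets a$ if $i=1$ or $\kappa_i=\kappa_{i-1}$, and $a'\gets 0$ otherwise; (2) (pack item $i$) if $q+w_i\le b$, let $s=(i,\,t+1,\,d+\sigma(a',d),\,a'+1,\,q+w_i)$ and set $f(s)\gets\max\{f(i-1,t,d,a,q)+p_i,\ f(s)\}$; (3) (do not pack item $i$) set $f(i,t,d,a',q)\gets\max\{f(i-1,t,d,a,q),\ f(i,t,d,a',q)\}$. Operations are elementary (arithmetic, comparison, table access) at unit cost. *)

(* Defs.v *)
From mathcomp Require Import all_boot all_order all_algebra.
From mathcomp Require Import constructive_ereal.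

Set Implicit Arguments.
Unset Strict Implicit.
Unset Printing Implicit Defensive.

Import Order.TTheory GRing.Theory Num.Theory.

Local Open Scope nat_scope.

(** * Instances *)

(* Item [i] of {1, .., n} is the ordinal [j : 'I_n] with [j.+1 = i], and the
   colors {1, .., m} are the elements of ['I_m]. *)
Record ckp := Ckp {
  nitems : nat;
  ncolors : nat;
  profit : 'I_nitems -> int;
  weight : 'I_nitems -> nat;
  color : 'I_nitems -> 'I_ncolors;
  capacity : nat;
  weight_gt0 : forall j, 0 < weight j;
  capacity_gt0 : 0 < capacity;
  capacity_lt : capacity < \sum_j weight j
}.

Definition sorted_by_color (I : ckp) : Prop :=
  forall j1 j2 j3 : 'I_(nitems I), j1 <= j2 -> j2 <= j3 ->
    color j1 = color j3 -> color j2 = color j1.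

Section Sets.
Variable I : ckp.
Implicit Types S : {set 'I_(nitems I)}.

Definition set_profit S : int := (\sum_(j in S) profit j)%R.
Definition set_weight S : nat := \sum_(j in S) weight j.
Definition color_count (c : 'I_(ncolors I)) S : nat :=
  #|[set j in S | color j == c]|.
Definition max_color_count S : nat := \max_(c < ncolors I) color_count c S.

(* For [0 < i <= n] exactly one [j] satisfies [j.+1 == i], and it is item [i],
   so that the fourth condition is [k_{kappa_i}(S) = a].  For [i = 0] that
   condition is void and the last one takes its place. *)
Definition admissible (i t d a q : nat) S : bool :=
  [&& [forall j in S, j.+1 <= i],
      #|S| == t,
      max_color_count S == d,
      [forall (j : 'I_(nitems I) | j.+1 == i), color_count (color j) S == a],
      set_weight S == q
    & (i == 0) ==> (a == 0)].

End Sets.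

(** * Programs with a table and a count of elementary operations *)

(* [(i, t, d, a, q)] *)
Definition index : Type := (nat * nat * nat * nat * nat)%type.
Definition table : Type := index -> \bar int.

(* A program maps the current table to its result, the table it leaves, and
   the number of elementary operations it performed. *)
Definition prog (A : Type) : Type := table -> A * table * nat.

Definition ret A (x : A) : prog A := fun T => (x, T, 0).
Definition bind A B (m : prog A) (k : A -> prog B) : prog B := fun T =>
  let: (x, T1, c1) := m T in
  let: (y, T2, c2) := k x T1 in
  (y, T2, c1 + c2).

Notation "'let!' x := m 'in' k" := (bind m (fun x => k))
  (at level 200, x name, m at level 100, k at level 200,
   format "'[v' 'let!'  x  :=  m  'in' '/' k ']'").

(* The only sources of cost, one unit each.  In [step e], [e] is to be a single
   arithmetic operation, comparison, or access to the input data. *)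
Definition step A (x : A) : prog A := fun T => (x, T, 1).
Definition get (s : index) : prog (\bar int) := fun T => (T s, T, 1).
Definition put (s : index) (v : \bar int) : prog unit := fun T =>
  (tt, fun s' => if s' == s then v else T s', 1).

(* Every iteration pays for a loop test and for advancing the loop variable;
   leaving the loop pays for the failing test. *)
Fixpoint for_each X (xs : seq X) (body : X -> prog unit) : prog unit :=
  if xs is x :: xs' then
    let! _ := step true in
    let! _ := body x in
    let! _ := step tt in
    for_each xs' body
  else let! _ := step false in ret tt.

Definition final_table A (m : prog A) (T : table) : table := (m T).1.2.
Definition operations A (m : prog A) (T : table) : nat := (m T).2.

(** * The algorithm *)

Section DP1.
Variable I : ckp.
Notation n := (nitems I).
Notation b := (capacity I).

Definition upto (k : nat) : seq nat := iota 0 k.+1.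

Definition dp1_init : prog unit :=
  let! _ := for_each (upto n) (fun i =>
    for_each (upto n) (fun t =>
    for_each (upto n) (fun d =>
    for_each (upto n) (fun a =>
    for_each (upto b) (fun q =>
      put (i, t, d, a, q) -oo%E))))) in
  put (0, 0, 0, 0, 0) 0%E.

(* Is [i = 1] or [kappa_i = kappa_{i-1}], for [i = j.+1]?  When [j] is not the
   first item, [ord_pred j] is the item just before it. *)
Definition same_color_run (j : 'I_n) : prog bool :=
  let! first := step (val j == 0) in
  if first then ret true else
  let! j' := step (ord_pred j) in
  let! c := step (color j) in
  let! c' := step (color j') in
  step (c == c').

Definition dp1_body (j : 'I_n) (t d a q : nat) : prog unit :=
  let! v := get (val j, t, d, a, q) in
  let! reachable := step (-oo < v)%E in
  if reachable then
    let! i := step j.+1 in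
    let! same := same_color_run j in
    let a' := if same then a else 0 in
    let! wi := step (weight j) in
    let! q' := step (q + wi) in
    let! fits := step (q' <= b) in
    let! _ :=
      if fits then
        let! t' := step t.+1 in
        let! sigma := step (d <= a' : nat) in
        let! d' := step (d + sigma) in
        let! a'' := step a'.+1 in
        let s := (i, t', d', a'', q') in
        let! pi := step (profit j) in
        let! v' := step (v + pi%:E)%E in
        let! old := get s in
        let! new := step (Order.max v' old) in
        put s new
      else ret tt in
    let s := (i, t, d, a', q) in
    let! old := get s in
    let! new := step (Order.max v old) in
    put s new
  else ret tt.

Definition DP1 : prog unit :=
  let! _ := dp1_init in
  for_each (enum 'I_n) (fun j =>
    for_each (upto n) (fun t =>
    for_each (upto n) (fun d =>
    for_each (upto n) (fun a =>
    for_each (upto b) (fun q =>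
      dp1_body j t d a q))))).

End DP1.

(* Main.v *)
Require Import Defs.
From mathcomp Require Import all_boot all_order all_algebra.
From mathcomp Require Import constructive_ereal zify.

(** A table entry depends on a packing [S] of the first [i] items only through
    the tuple [state i S], and this tuple contains all that is needed to extend
    [S] by the next item.  Sortedness enters at one point: the number of items
    of [S] having the color of the next item is the last counter of the tuple
    if that item continues the current color, and [0] if it starts a new one,
    because the color then has not occurred before ([color_count_run]).  Hence
    the states of [S] and of [S] with item [j] added are the two targets that
    the algorithm computes from [state j S] ([state_skip], [state_pack]).

    Correctness is an induction on the layers ([filled_pass]).  Every value
    written to layer [j.+1] is at most the optimum there, since an optimal
    packing behind the value read extends to a packing behind the value written
    ([best_skip], [best_pack]).  Conversely a packing of the first [j.+1] items
    comes from one of the first [j] items ([split_packing]), whose state is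
    visited during the pass; this visit raises the entry to the profit of the
    packing, and entries never decrease afterwards.  The induction also covers
    the states that no packing realizes: their optimum is minus infinity, so
    that the reachability test discards only sources with nothing to extend.

    The cost is that of five nested loops.  As the capacity is positive and
    smaller than the total weight, there is an item, and [n.+1] and [b.+1] are
    at most twice [n] and [b], so every loop over a coordinate multiplies the
    cost by a constant times [n] or [b]. *)

Set Implicit Arguments.
Unset Strict Implicit.
Unset Printing Implicit Defensive.

Import Order.TTheory GRing.Theory Num.Theory.

Local Open Scope nat_scope.

(** * Loops *)

Lemma final_bind A B (m : prog A) (k : A -> prog B) T :
  final_table (bind m k) T = final_table (k (m T).1.1) (final_table m T).
Proof.
rewrite /final_table /bind; case: (m T) => [[x T1] c1] /=.
by case: (k x T1) => [[y T2] c2].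
Qed.

Lemma operations_bind A B (m : prog A) (k : A -> prog B) T :
  operations (bind m k) T =
  operations m T + operations (k (m T).1.1) (final_table m T).
Proof.
rewrite /operations /final_table /bind; case: (m T) => [[x T1] c1] /=.
by case: (k x T1) => [[y T2] c2].
Qed.

Lemma final_for_each_cons X (x : X) xs body T :
  final_table (for_each (x :: xs) body) T =
  final_table (for_each xs body) (final_table (body x) T).
Proof. by rewrite /= !final_bind. Qed.

Lemma final_for_each_cat X (xs ys : seq X) body T :
  final_table (for_each (xs ++ ys) body) T =
  final_table (for_each ys body) (final_table (for_each xs body) T).
Proof.
by elim: xs T => [|x xs IH] T //; rewrite cat_cons !final_for_each_cons IH.
Qed.

Lemma final_for_each_map X Y (h : X -> Y) xs body T :
  final_table (for_each [seq h x | x <- xs] body) T =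
  final_table (for_each xs (fun x => body (h x))) T.
Proof.
by elim: xs T => [|x xs IH] T //; rewrite map_cons !final_for_each_cons IH.
Qed.

Definition pairs X Y (xs : seq X) (ys : seq Y) : seq (X * Y) :=
  [seq (x, y) | x <- xs, y <- ys].

Lemma mem_pairs (X Y : eqType) (xs : seq X) (ys : seq Y) z :
  (z \in pairs xs ys) = (z.1 \in xs) && (z.2 \in ys).
Proof.
apply/allpairsP/andP => [[p [xp yp ->]] //|[xz yz]].
by exists z; split=> //; case: z {xz yz}.
Qed.

(** Loop overhead changes only the operation count, so that nested loops leave
    the same table as one loop over tuples; one invariant then suffices for a
    whole nest. *)
Lemma final_for_each_pairs X Y (xs : seq X) (ys : seq Y) body T :
  final_table (for_each xs (fun x => for_each ys (body x))) T =
  final_table (for_each (pairs xs ys) (fun p => body p.1 p.2)) T.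
Proof.
elim: xs T => [|x xs IH] T //.
by rewrite final_for_each_cons /pairs allpairs_cons final_for_each_cat
           final_for_each_map IH.
Qed.

Lemma for_each_inv (X : eqType) (xs : seq X) body (P : table -> Prop) T :
    (forall x T', x \in xs -> P T' -> P (final_table (body x) T')) ->
  P T -> P (final_table (for_each xs body) T).
Proof.
elim: xs T => [|x xs IH] T // stepP PT; rewrite final_for_each_cons.
apply: IH => [y T' xs_y|]; last by apply: stepP; rewrite ?mem_head.
by apply: stepP; rewrite in_cons xs_y orbT.
Qed.

(** The progress rule: it serves to show that the visit of one particular state
    leaves a trace [Q] in the final table, whatever the other visits do. *)
Lemma for_each_reaches (X : eqType) (xs : seq X) body (P Q : table -> Prop)
    x0 T :
    x0 \in xs ->
    (forall x T', x \in xs -> P T' -> P (final_table (body x) T')) ->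
    (forall T', P T' -> Q (final_table (body x0) T')) ->
    (forall x T', x \in xs -> P T' -> Q T' -> Q (final_table (body x) T')) ->
  P T -> Q (final_table (for_each xs body) T).
Proof.
case/splitPr=> xs1 xs2 stepP reachQ stepQ PT.
have stepPQ x T' : x \in xs1 ++ x0 :: xs2 -> P T' /\ Q T' ->
    P (final_table (body x) T') /\ Q (final_table (body x) T').
  by move=> xs_x [PT' QT']; split; [apply: stepP | apply: stepQ].
rewrite final_for_each_cat final_for_each_cons.
have PT1 : P (final_table (for_each xs1 body) T).
  apply: for_each_inv PT => x T' xs_x; apply: stepP.
  by rewrite mem_cat xs_x.
apply: (for_each_inv (P := fun T' => P T' /\ Q T') _ _).2.
  by move=> x T' xs_x; apply: stepPQ; rewrite mem_cat in_cons xs_x !orbT.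
by split; [apply: stepP; rewrite // mem_cat mem_head orbT | apply: reachQ].
Qed.

Lemma mem_upto k x : (x \in upto k) = (x <= k).
Proof. by rewrite mem_iota. Qed.

Lemma for_each_cost X (xs : seq X) body K T :
    (forall x T', operations (body x) T' <= K) ->
  operations (for_each xs body) T <= size xs * (K + 2) + 1.
Proof.
move=> bodyK; elim: xs T => [|x xs IH] T //=.
rewrite !operations_bind /= mulSn -addnA.
set T1 := final_table _ _; set T2 := final_table _ _; set T3 := final_table _ _.
have:= leq_add (bodyK x T1) (IH T3).
rewrite /operations /=; lia.
Qed.

(** A loop over [0 .. k] multiplies the cost by at most [8 * k]: it has at most
    [2 * k] iterations, and its overhead, two units per iteration and one at the
    exit, is at most three units per iteration.  The bound is a product of a
    constant and a size so that it can be iterated over nested loops. *)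
Lemma for_each_upto_cost k body K M T : 0 < k -> 0 < K -> 0 < M ->
    (forall x T', operations (body x) T' <= K * M) ->
  operations (for_each (upto k) body) T <= 8 * K * (k * M).
Proof.
move=> k_gt0 K_gt0 M_gt0 bodyK.
apply: leq_trans (for_each_cost _ _ bodyK) _; rewrite size_iota.
have -> : 8 * K * (k * M) = 8 * (k * (K * M)).
  by rewrite -mulnA [K * (k * M)]mulnCA.
have : 0 < K * M by rewrite muln_gt0 K_gt0.
move: (K * M) => N N_gt0; nia.
Qed.

(** * Packings of the first items *)

Section Packings.
Variable I : ckp.
Notation n := (nitems I).
Notation b := (capacity I).
Implicit Types (S : {set 'I_n}) (j : 'I_n) (s : Defs.index) (T : table).

Definition first_items i : {set 'I_n} := [set j : 'I_n | j < i].

(** At most one item satisfies the condition, so the maximum is its color count;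
    for [i = 0] it is empty and gives the value [0] that admissibility asks
    for. *)
Definition last_count i S : nat :=
  \max_(j : 'I_n | j.+1 == i) color_count (color j) S.

Definition state i S : Defs.index :=
  (i, #|S|, max_color_count S, last_count i S, set_weight S).

Definition layer s : nat := s.1.1.1.1.

Definition realizes s S : bool :=
  (S \subset first_items (layer s)) && (state (layer s) S == s).

Definition best s : \bar int :=
  \big[Order.max/-oo%E]_(S | realizes s S) (set_profit S)%:E.

Lemma last_count_succ j S : last_count j.+1 S = color_count (color j) S.
Proof. by apply: big_pred1 => k; rewrite eqSS. Qed.

Lemma last_count0 S : last_count 0 S = 0.
Proof. by apply: big_pred0 => k. Qed.

Lemma admissibleE i t d a q S : i <= n ->
  admissible i t d a q S = realizes (i, t, d, a, q) S.
Proof.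
move=> le_in; rewrite /admissible /realizes /layer /state /= !xpair_eqE eqxx /=.
have -> : [forall j in S, j.+1 <= i] = (S \subset first_items i).
  apply/forall_inP/subsetP => sub j Sj.
    by rewrite inE sub.
  by have:= sub j Sj; rewrite inE.
have <- : [forall (j : 'I_n | j.+1 == i), color_count (color j) S == a]
          && ((i == 0) ==> (a == 0)) = (last_count i S == a).
  case: i le_in => [|i] lt_in.
    rewrite last_count0 eqxx /= [0 == a]eq_sym andb_idl // => _.
    by apply/forallP.
  rewrite andbT (last_count_succ (Ordinal lt_in)).
  apply/forall_inP/eqP => [count_a|<- j].
    exact/eqP/(count_a (Ordinal lt_in)).
  rewrite eqSS => /eqP ji; apply/eqP.
  by congr (color_count (color _) S); apply: val_inj.
by rewrite -!andbA [(_ == q) && _]andbC.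
Qed.

Lemma color_count_setU1 c j S : j \notin S ->
  color_count c (j |: S) = color_count c S + (color j == c).
Proof.
move=> notSj; rewrite /color_count; have [<-|ne_jc] := eqVneq.
  have -> : [set k in j |: S | color k == color j] =
            j |: [set k in S | color k == color j].
    apply/setP => k; rewrite !inE; have [->|//] := eqVneq k j.
    by rewrite eqxx.
  by rewrite cardsU1 inE (negPf notSj) addnC.
rewrite addn0; apply: eq_card => k; rewrite !inE.
by have [->|//] := eqVneq k j; rewrite (negPf ne_jc) !andbF.
Qed.

Lemma color_count_sub c S S' : S \subset S' ->
  color_count c S <= color_count c S'.
Proof.
move=> /subsetP sub; apply/subset_leq_card/subsetP => k.
by rewrite !inE => /andP[/sub -> ->].
Qed.

Lemma color_count_le_max c S : color_count c S <= max_color_count S.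
Proof. exact: (leq_bigmax (F := fun c => color_count c S)). Qed.

(** Only the color of the new item can exceed the old maximum, and it does so,
    by one, exactly when it already attained that maximum. *)
Lemma max_color_count_setU1 j S : j \notin S ->
  max_color_count (j |: S) =
  max_color_count S + (max_color_count S <= color_count (color j) S).
Proof.
move=> notSj; apply/eqP; rewrite eqn_leq; apply/andP; split.
  apply/bigmax_leqP => c _; rewrite color_count_setU1 //.
  have := color_count_le_max c S; have [->|_] := eqVneq; lia.
have [le_max|_] := leqP (max_color_count S).
  apply: leq_trans (color_count_le_max (color j) _).
  by rewrite color_count_setU1 // eqxx leq_add.
rewrite addn0; apply/bigmax_leqP => c _.
by apply: leq_trans (color_count_le_max c _); apply/color_count_sub/subsetUr.
Qed.

Definition continues_run j : bool :=
  (j == 0 :> nat) || (color j == color (ord_pred j)).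

Definition run_count j (a : nat) : nat := if continues_run j then a else 0.

Lemma ord_predK j : 0 < j -> (ord_pred j).+1 = j.
Proof.
move=> j_gt0; have -> : val (ord_pred j) = (j + n).-1 %% n by [].
have -> : (j + n).-1 = j.-1 + n by lia.
by rewrite modnDr modn_small prednK // ltnW.
Qed.

(** If item [j] starts a new color while an earlier item [k] has the same one,
    the predecessor of [j] lies between them and breaks the sorting. *)
Lemma color_count_run j S : sorted_by_color I -> S \subset first_items j ->
  color_count (color j) S = run_count j (last_count j S).
Proof.
move=> sorted /subsetP subS; rewrite /run_count /continues_run.
have [j0|j_gt0] := posnP j.
  rewrite j0 last_count0; apply: eq_card0 => k; rewrite !inE.
  by apply/negP => /andP[/subS]; rewrite inE j0.
rewrite -(ord_predK j_gt0) last_count_succ.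
case: eqP => [-> //|ne_color]; apply: eq_card0 => k; rewrite !inE.
apply/negP => /andP[/subS]; rewrite inE => lt_kj /eqP color_k.
have pred_j := ord_predK j_gt0.
by case: ne_color; rewrite -color_k; apply/esym/(sorted k _ j) => //; lia.
Qed.

Lemma state_skip j S : sorted_by_color I -> S \subset first_items j ->
  state j.+1 S =
  (j.+1, #|S|, max_color_count S, run_count j (last_count j S), set_weight S).
Proof.
by move=> sorted subS; rewrite /state last_count_succ color_count_run.
Qed.

Lemma notin_first_items j S : S \subset first_items j -> j \notin S.
Proof. by move/subsetP=> subS; apply/negP => /subS; rewrite inE ltnn. Qed.

Lemma state_pack j S : sorted_by_color I -> S \subset first_items j ->
  let a' := run_count j (last_count j S) in
  state j.+1 (j |: S) =
  (j.+1, #|S|.+1, max_color_count S + (max_color_count S <= a'), a'.+1,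
   set_weight S + weight j).
Proof.
move=> sorted subS /=; have notSj := notin_first_items subS.
rewrite /state last_count_succ max_color_count_setU1 // color_count_setU1 //.
rewrite color_count_run // eqxx addn1 cardsU1 notSj.
by rewrite add1n /set_weight big_setU1 //= [weight j + _]addnC.
Qed.

Lemma first_itemsS j : first_items j \subset first_items j.+1.
Proof. by apply/subsetP => k; rewrite !inE => /ltnW. Qed.

Lemma setU1_first_items j S : S \subset first_items j ->
  j |: S \subset first_items j.+1.
Proof.
move=> subS; rewrite subUset sub1set inE ltnSn.
exact: subset_trans (first_itemsS j).
Qed.

Lemma split_packing j S : S \subset first_items j.+1 ->
  exists2 S' : {set 'I_n}, S' \subset first_items j & S = S' \/ S = j |: S'.
Proof.
move=> /subsetP subS; exists (S :\ j).
  apply/subsetP => k; rewrite !inE => /andP[ne_kj /subS].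
  by rewrite inE ltnS leq_eqVlt val_eqE (negPf ne_kj).
case: (boolP (j \in S)) => [Sj|notSj]; last left.
  by right; rewrite setD1K.
by apply/setP => k; rewrite !inE; case: eqP => [->|//]; rewrite (negPf notSj).
Qed.

Lemma le_best S i : S \subset first_items i ->
  ((set_profit S)%:E <= best (state i S))%E.
Proof. by move=> subS; apply: le_bigmax_cond; rewrite /realizes subS eqxx. Qed.

Lemma best_le s (v : \bar int) :
  (forall S, realizes s S -> ((set_profit S)%:E <= v)%E) -> (best s <= v)%E.
Proof. by move=> le_v; apply: bigmax_le => //; exact: leNye. Qed.

(** A packing of the first [j] items keeps its profit when item [j] is skipped.
    The optimum over no packing at all is minus infinity, hence below anything,
    so that unreachable sources fit in. *)
Lemma best_skip j t d a q : sorted_by_color I ->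
  (best (val j, t, d, a, q) <= best (j.+1, t, d, run_count j a, q))%E.
Proof.
move=> sorted; apply: best_le => S /andP[subS /eqP[<- <- <- <-]].
rewrite -state_skip //; apply: le_best; exact: subset_trans (first_itemsS j).
Qed.

Lemma set_profit_pack j S : j \notin S ->
  ((set_profit (j |: S))%:E = (set_profit S)%:E + (profit j)%:E)%E.
Proof. by move=> notSj; rewrite /set_profit big_setU1 //= addrC EFinD. Qed.

Lemma best_pack j t d a q : sorted_by_color I ->
  (best (val j, t, d, a, q) + (profit j)%:E <=
   best (j.+1, t.+1, d + (d <= run_count j a), (run_count j a).+1,
         q + weight j)%N)%E.
Proof.
move=> sorted; rewrite -leeBrDr //.
apply: best_le => S /andP[subS /eqP[<- <- <- <-]].
rewrite leeBrDr // -set_profit_pack ?notin_first_items // -state_pack //.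
exact/le_best/setU1_first_items.
Qed.

Lemma best0 t d a q :
  best (0, t, d, a, q) =
  if (t, d, a, q) == (0, 0, 0, 0) then 0%E else -oo%E.
Proof.
have realizes0 S : realizes (0, t, d, a, q) S =
    (S == set0) && ((t, d, a, q) == (0, 0, 0, 0)).
  have -> : (S == set0) = (S \subset first_items 0).
    by rewrite -subset0; congr (_ \subset _); apply/setP => k; rewrite !inE.
  rewrite /realizes /=; case: (boolP (_ \subset _)) => // subS.
  have S0 : S = set0.
    by apply/setP => k; rewrite inE; apply/negP => /(subsetP subS); rewrite inE.
  have max0 : max_color_count S = 0.
    rewrite S0; apply/eqP; rewrite -leqn0; apply/bigmax_leqP => c _.
    by rewrite leqn0 cards_eq0; apply/eqP/setP => k; rewrite !inE.
  rewrite /state max0 last_count0 /set_weight S0 cards0 big_set0.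
  by rewrite eq_sym !xpair_eqE.
rewrite /best (eq_bigl _ _ realizes0); case: eqP => _.
  under eq_bigl do rewrite andbT.
  by rewrite big_pred1_eq /set_profit big_set0.
by rewrite big_pred0 // => S; rewrite andbF.
Qed.

(** * Passes over the table *)

(** The effect of the update [f(s) <- max {v, f(s)}]. *)
Definition raise s (v : \bar int) T : table :=
  fun s' => if s' == s then Order.max v (T s) else T s'.

Lemma raise_ge s v T s' : (T s' <= raise s v T s')%E.
Proof. by rewrite /raise; case: eqP => [->|//]; rewrite le_max lexx orbT. Qed.

Lemma raise_at s v T : (v <= raise s v T s)%E.
Proof. by rewrite /raise eqxx le_max lexx. Qed.

Lemma final_same_color_run j (k : bool -> prog unit) T :
  final_table (bind (same_color_run j) k) T =
  final_table (k (continues_run j)) T.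
Proof.
rewrite final_bind /same_color_run /continues_run /bind /step /ret /final_table.
by case: eqP.
Qed.

Lemma final_dp1_body j t d a q T :
  let v := T (val j, t, d, a, q) in
  let a' := run_count j a in
  final_table (dp1_body j t d a q) T =
  if (-oo < v)%E then
    raise (j.+1, t, d, a', q) v
      (if q + weight j <= b then
         raise (j.+1, t.+1, d + (d <= a'), a'.+1, q + weight j)
           (v + (profit j)%:E)%E T
       else T)
  else T.
Proof.
move=> v a'; rewrite /dp1_body 2!final_bind /= -/v.
have -> : final_table (get (val j, t, d, a, q)) T = T by [].
case: (-oo < v)%E => //.
rewrite final_bind final_same_color_run 4!final_bind /=.
by case: (q + weight j <= b); rewrite ?final_bind.
Qed.

Definition in_box s : bool :=
  let: (i, t, d, a, q) := s in
  [&& i <= n, t <= n, d <= n, a <= n & q <= b].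

(** Entries outside the box keep their arbitrary initial values, so the
    invariant is restricted to the box.  That the layers above [k] are still at
    minus infinity is what makes the next pass produce no value too large. *)
Definition filled (k : nat) T : Prop := forall s, in_box s ->
  T s = if layer s <= k then best s else -oo%E.

Lemma filled_init T : filled 0 (final_table (dp1_init I) T).
Proof.
rewrite /dp1_init final_bind !final_for_each_pairs.
set loop := final_table _ T => s box_s.
have -> : final_table (put (0, 0, 0, 0, 0) 0%E) loop s =
  if s == (0, 0, 0, 0, 0) then 0%E else loop s by [].
have -> : loop s = -oo%E.
  apply: (for_each_reaches (P := fun=> True) (Q := fun T' => T' s = -oo%E)
            (x0 := s)) => //.
  - by case: s box_s => [[[[i t] d] a] q]; rewrite !mem_pairs !mem_upto -!andbA.
  - by move=> T' _; case: s {box_s} => [[[[i t] d] a] q];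
      rewrite /final_table /= eqxx.
  - by move=> s' T' _ _ T's; rewrite /final_table /=; case: ifP.
case: s {box_s loop} => [[[[[|i] t] d] a] q] //.
by rewrite /layer /= best0.
Qed.

Lemma max_color_count_le S : max_color_count S <= #|S|.
Proof.
apply/bigmax_leqP => c _; apply/subset_leq_card/subsetP => k.
by rewrite inE => /andP[].
Qed.

Lemma last_count_le i S : last_count i S <= #|S|.
Proof.
apply/bigmax_leqP => j _.
exact: leq_trans (color_count_le_max _ _) (max_color_count_le S).
Qed.

Lemma in_box_state i S : i <= n -> set_weight S <= b -> in_box (state i S).
Proof.
move=> le_in le_wb; have card_n : #|S| <= n.
  by rewrite -[X in _ <= X]card_ord max_card.
rewrite /in_box /state le_in le_wb card_n andbT /=.
rewrite (leq_trans (max_color_count_le S)) //.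
exact: leq_trans (last_count_le i S) card_n.
Qed.

Definition dp1_pass j : prog unit :=
  for_each (upto n) (fun t => for_each (upto n) (fun d =>
  for_each (upto n) (fun a => for_each (upto b) (fun q =>
    dp1_body j t d a q)))).

(** The pass reads layer [j] and writes layer [j.+1] only, so that all values
    read are optima.  The upper bound on layer [j.+1] is invariant, and each
    packing of the first [j.+1] items gets its profit recorded when the state of
    its restriction to the first [j] items is visited. *)
Lemma filled_pass j T : sorted_by_color I ->
  filled j T -> filled j.+1 (final_table (dp1_pass j) T).
Proof.
move=> sorted filledT; rewrite /dp1_pass !final_for_each_pairs.
set states := pairs _ _; set body := fun p : nat * nat * nat * nat => _.
have in_states t d a q : ((t, d, a, q) \in states) =
    [&& t <= n, d <= n, a <= n & q <= b].
  by rewrite !mem_pairs !mem_upto -!andbA.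
pose P (T' : table) :=
  (forall s, layer s != j.+1 -> T' s = T s) /\
  (forall s, in_box s -> layer s = j.+1 -> (T' s <= best s)%E).
have T_read t d a q T' : (t, d, a, q) \in states -> P T' ->
    T' (val j, t, d, a, q) = best (val j, t, d, a, q).
  rewrite in_states => box_p [same _]; rewrite same /layer /=; last first.
    by rewrite ltn_eqF.
  by rewrite filledT /layer /= ?leqnn // (ltnW (ltn_ord j)).
have P_raise s v T' : layer s = j.+1 -> (v <= best s)%E -> P T' ->
    P (raise s v T').
  move=> layer_s le_v [same le_best']; split=> s'.
    move=> ne_layer; rewrite /raise; case: eqP => [ss'|_]; last exact: same.
    by rewrite ss' layer_s eqxx in ne_layer.
  rewrite /raise; case: eqP => [->|_]; last exact: le_best'.
  by move=> box_s _; rewrite ge_max le_v le_best'.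
have P_body p T' : p \in states -> P T' -> P (final_table (body p) T').
  case: p => [[[t d] a] q] states_p PT'; rewrite final_dp1_body /= T_read //.
  case: ifP => // _; apply: (P_raise); rewrite ?best_skip //.
  by case: ifP => // _; apply: (P_raise); rewrite ?best_pack.
have body_ge p T' s : (T' s <= final_table (body p) T' s)%E.
  case: p => [[[t d] a] q]; rewrite final_dp1_body /=.
  case: ifP => // _; apply: le_trans (raise_ge _ _ _ _).
  by case: ifP => // _; apply: raise_ge.
have PT : P T.
  split=> // s box_s layer_s; rewrite filledT // layer_s ltnn; exact: leNye.
have [same le_best'] := for_each_inv P_body PT.
move=> s box_s; have [layer_s|ne_layer] := eqVneq (layer s) j.+1; last first.
  rewrite same // filledT //; congr (if _ then _ else _); lia.
rewrite layer_s leqnn; apply/le_anti; rewrite le_best' //=.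
(* The visit of the state of [S'] records the profit of [S]. *)
apply: best_le => S; rewrite /realizes layer_s => /andP[subS /eqP def_s].
have [S' subS' def_S] := split_packing subS.
have le_wb : set_weight S <= b.
  by move: box_s; rewrite -def_s => /and5P[].
have le_wS' : set_weight S' <= set_weight S.
  case: def_S => [->//|->]; rewrite /set_weight big_setU1 ?leq_addl //=.
  exact: notin_first_items.
have box_S' : in_box (state j S').
  by apply: in_box_state; [exact: ltnW | exact: leq_trans le_wb].
pose p0 := (#|S'|, max_color_count S', last_count j S', set_weight S').
have states_p0 : p0 \in states by rewrite in_states; case/andP: box_S'.
apply: (for_each_reaches (Q := fun T' => ((set_profit S)%:E <= T' s)%E)
          states_p0 P_body) PT => [T' PT'|p T' _ _ le_T']; last first.
  exact: le_trans le_T' (body_ge _ _ _).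
rewrite /body final_dp1_body /= T_read //.
have le_v := le_best subS'; rewrite -/(state j S').
rewrite (lt_le_trans (ltNyr _) le_v) -def_s.
case: def_S => def_S; rewrite def_S.
  rewrite state_skip //; exact: le_trans le_v (raise_at _ _ _).
apply: le_trans (raise_ge _ _ _ _).
have state_S := state_pack sorted subS'.
have notS'j := notin_first_items subS'.
rewrite ifT; last first.
  by rewrite addnC; move: le_wb; rewrite def_S /set_weight big_setU1.
rewrite state_S set_profit_pack //; apply: le_trans (raise_at _ _ _).
exact: leeD2r.
Qed.

Lemma filled_DP1 T : sorted_by_color I -> filled n (final_table (DP1 I) T).
Proof.
move=> sorted; rewrite /DP1 final_bind; set T1 := final_table (dp1_init I) T.
suff filled_take k : k <= n ->
    filled k (final_table (for_each (take k (enum 'I_n)) dp1_pass) T1).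
  have := filled_take n (leqnn n).
  by rewrite -[X in take X _]size_enum_ord take_size.
elim: k => [|k IH] lt_kn; first by rewrite take0; apply: filled_init.
rewrite (take_nth (Ordinal lt_kn)) ?size_enum_ord //.
rewrite (nth_ord_enum (Ordinal lt_kn) (Ordinal lt_kn)) -cats1.
rewrite final_for_each_cat final_for_each_cons.
exact/(@filled_pass (Ordinal lt_kn))/IH/ltnW.
Qed.

(** * The number of operations *)

Lemma nitems_gt0 : 0 < n.
Proof.
rewrite lt0n; apply/eqP => n0; have := capacity_lt I.
by rewrite big1 // => j; have := ltn_ord j; rewrite [X in _ < X]n0.
Qed.

(** The bound is attained when item [j] is packed and is not the first: [2]
    operations to read and test the entry, [9] for the new index, the color
    comparison and the capacity test, [9] for packing and [3] for skipping. *)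
Lemma operations_dp1_body j t d a q T : operations (dp1_body j t d a q) T <= 23.
Proof.
rewrite /dp1_body /same_color_run /operations /bind /get /put /step /ret /=.
by do !case: ifP => _ /=.
Qed.

Lemma operations_dp1_init T :
  operations (dp1_init I) T <=
  (8 * (8 * (8 * (8 * (8 * 1)))) + 1) * (b * n ^ 4).
Proof.
have n_gt0 := nitems_gt0; have b_gt0 := capacity_gt0 I.
rewrite /dp1_init operations_bind.
have -> : b * n ^ 4 = n * (n * (n * (n * (b * 1)))).
  by rewrite !expnS expn0; lia.
rewrite mulnDl; apply: leq_add; last by rewrite mul1n !muln_gt0 n_gt0 b_gt0.
do 5! [apply: for_each_upto_cost; rewrite ?muln_gt0 ?n_gt0 ?b_gt0 // => ? ?].
Qed.

Lemma operations_dp1_pass j T :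
  operations (dp1_pass j) T <=
  8 * (8 * (8 * (8 * 23))) * (n * (n * (n * (b * 1)))).
Proof.
have n_gt0 := nitems_gt0; have b_gt0 := capacity_gt0 I.
rewrite /dp1_pass.
do 4! [apply: for_each_upto_cost; rewrite ?muln_gt0 ?n_gt0 ?b_gt0 // => ? ?].
by rewrite muln1; apply: operations_dp1_body.
Qed.

(** The summand [3] absorbs the overhead of the loop over the items. *)
Lemma operations_DP1 T :
  operations (DP1 I) T <=
  (8 * (8 * (8 * (8 * (8 * 1)))) + 1 + (8 * (8 * (8 * (8 * 23))) + 3))
  * (b * n ^ 4).
Proof.
rewrite /DP1 operations_bind mulnDl; apply: leq_add.
  exact: operations_dp1_init.
apply: leq_trans (for_each_cost _ _ operations_dp1_pass) _.
rewrite size_enum_ord; move: (8 * _) => K.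
have -> : b * n ^ 4 = n * (n * (n * (n * (b * 1)))).
  by rewrite !expnS expn0; lia.
have : 0 < n * (n * (n * (b * 1))).
  by rewrite !muln_gt0 nitems_gt0 capacity_gt0.
have := nitems_gt0; move: (n * (n * (n * (b * 1)))) => N n_gt0 N_gt0.
nia.
Qed.

End Packings.

Theorem proposition2 :
  exists C : nat, forall (I : ckp) (T0 : table), sorted_by_color I ->
    (forall i t d a q : nat,
        i <= nitems I -> t <= nitems I -> d <= nitems I -> a <= nitems I ->
        q <= capacity I ->
        (exists S : {set 'I_(nitems I)}, admissible i t d a q S) ->
        final_table (DP1 I) T0 (i, t, d, a, q) =
        \big[Order.max/-oo%E]_(S : {set 'I_(nitems I)} | admissible i t d a q S)
          (set_profit S)%:E)
    /\ operations (DP1 I) T0 <= C * (capacity I * nitems I ^ 4).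
Proof.
eexists => I T0 sorted; split; last exact: operations_DP1.
move=> i t d a q le_in le_tn le_dn le_an le_qb _.
rewrite (filled_DP1 T0 sorted); last by rewrite /in_box le_in le_tn le_dn le_an.
rewrite /layer /= le_in; apply: eq_bigl => S.
by rewrite admissibleE.
Qed.
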